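(* Let $A$ be a unital $C^{\ast}$-algebra with unit $1$ and let $a, b \in A$ be self-adjoint. Then $|a - b| + |a + b - 1| = 1$ if and only if $a, b \in [0,1]$ and $a \circ b = a \dot\wedge b$.
   Context: For $x \in A$, $|x| := (x^{\ast}x)^{1/2}$. $[0,1] = \{x \in A : 0 \le x \le 1\}$ in the usual order of self-adjoint elements. For $a,b\in A$, $a \circ b := \frac12(ab + ba)$, and for self-adjoint $a,b$, $a \dot\wedge b := \frac12 (a + b - |a - b|)$. *)

(* Defs.v *)
From HB Require Import structures.
From mathcomp Require Import all_boot all_order all_algebra.
From mathcomp Require Import complex.
From mathcomp Require Import all_classical all_reals all_analysis.

Set Implicit Arguments.
Unset Strict Implicit.
Unset Printing Implicit Defensive.

Import Order.TTheory GRing.Theory Num.Theory.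
Import numFieldNormedType.Exports.

Local Open Scope classical_set_scope.
Local Open Scope ring_scope.
Local Open Scope complex_scope.

(* Completeness and the norm (with values in R[i]) come from
   completeNormedModType.  The mixin supplies the multiplication, because a join
   of a ring structure with a normed space in the hierarchy is rejected (missing
   join with numDomainType); the ring structure is declared afterwards.  Only a
   pzRingType is obtained, as the zero algebra is allowed. *)
HB.mixin Record CompleteNormedModule_isCStarAlgebra (R : realType) A
    of CompleteNormedModule R[i] A := {
  cstar_one : A ;
  cstar_mul : A -> A -> A ;
  cstar_mulA : associative cstar_mul ;
  cstar_mul1l : left_id cstar_one cstar_mul ;
  cstar_mul1r : right_id cstar_one cstar_mul ;
  cstar_mulDl : left_distributive cstar_mul +%R ;
  cstar_mulDr : right_distributive cstar_mul +%R ;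
  cstar_scaleAl : forall (k : R[i]) (x y : A),
    k *: cstar_mul x y = cstar_mul (k *: x) y ;
  cstar_scaleAr : forall (k : R[i]) (x y : A),
    k *: cstar_mul x y = cstar_mul x (k *: y) ;
  cstar_normM : forall x y : A, `|cstar_mul x y| <= `|x| * `|y| ;
  star : A -> A ;
  starD : forall x y : A, star (x + y) = star x + star y ;
  starZ : forall (k : R[i]) (x : A), star (k *: x) = Num.conj k *: star x ;
  starM : forall x y : A,
    star (cstar_mul x y) = cstar_mul (star y) (star x) ;
  starK : forall x : A, star (star x) = x ;
  cstar_norm : forall x : A, `|cstar_mul (star x) x| = `|x| ^+ 2
}.

#[short(type="cstarAlgType")]
HB.structure Definition CStarAlgebra (R : realType) :=
  {A of CompleteNormedModule R[i] A & CompleteNormedModule_isCStarAlgebra R A}.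

HB.instance Definition _ (R : realType) (A : cstarAlgType R) :=
  GRing.Zmodule_isPzRing.Build (CStarAlgebra.sort A)
    (@cstar_mulA R A) (@cstar_mul1l R A) (@cstar_mul1r R A)
    (@cstar_mulDl R A) (@cstar_mulDr R A).

Section CStarTheory.
Context {R : realType} {A : cstarAlgType R}.
Implicit Types x y a b : A.

Definition selfadjoint x : Prop := star x = x.

Definition invertible x : Prop := exists y, x * y = 1 /\ y * x = 1.

Definition spectrum x : set R[i] :=
  [set z | ~ invertible (z *: (1 : A) - x)].

(* In R[i], 0 <= z means that z is real and nonnegative. *)
Definition positive x : Prop :=
  selfadjoint x /\ forall z, spectrum x z -> 0 <= z.

Definition cle x y : Prop := positive (y - x).

Definition unit_interval : set A :=
  [set x | [/\ selfadjoint x, cle 0 x & cle x 1]].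

(* The positive square root, which exists and is unique for x positive; for
   other x the value is the junk value 0. *)
Definition csqrt x : A := xget 0 [set y | positive y /\ y ^+ 2 = x].

Definition cabs x : A := csqrt (star x * x).

Definition jordan a b : A := (2^-1 : R[i]) *: (a * b + b * a).

Definition dotmeet a b : A := (2^-1 : R[i]) *: (a + b - cabs (a - b)).

End CStarTheory.

Arguments unit_interval {R} A.

(* Main.v *)
(* Write p = |a - b| and q = |a + b - 1|.  Since p^2 = (a - b)^2,
   q^2 = (1 - p)^2 + 2 (ab + ba - (a + b - p)), so q = 1 - p is equivalent to
   a o b = (a + b - p) / 2 together with 1 - p >= 0, while the order bounds on
   a and b come from 2a = (p + (a - b)) + (q + (a + b - 1)) and its variants.

   The order theory behind this avoids holomorphic functional calculus.  If
   ||z|| <= 1, the iteration k := (z + k^2) / 2 converges to the only k of norm at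
   most 1 with (1 - k)^2 = 1 - z, by comparison with the scalar case z = 1.  This
   gives square roots and ||x^2 + g^2|| >= ||x||^2 for commuting self-adjoint x, g,
   and with these a self-adjoint x such that ||x|| = 1 cannot have 1 - x^2
   invertible.  Hence positivity in terms of the spectrum is the condition
   ||t - a|| <= t for some real t, which defines a convex cone. *)
Require Import Defs.
From mathcomp Require Import all_boot all_order all_algebra.
From mathcomp Require Import complex.
From mathcomp Require Import all_classical all_reals all_analysis.
From mathcomp Require Import ring lra.
Set Implicit Arguments.
Unset Strict Implicit.
Unset Printing Implicit Defensive.
Import Order.TTheory GRing.Theory Num.Theory.
Import numFieldNormedType.Exports.
Local Open Scope classical_set_scope.
Local Open Scope ring_scope.

Section CStarOrder.
Context {R : realType} {A : cstarAlgType R}.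
Implicit Types (x y z a b c : A) (r s t : R).

(** * Real scalars and the real-valued norm *)

(* Scalar multiplication by a real, kept apart from the complex scaling so that
   all norm computations take place in [R]. *)
Definition rscale r x : A := (real_complex R r) *: x.
Definition rnorm x : R := complex.Re `|x|.

Local Infix "*r" := rscale (at level 40).

Lemma rnormE x : `|x| = real_complex R (rnorm x).
Proof. by rewrite /rnorm RRe_real // normr_real. Qed.

Lemma rnorm_ge0 x : 0 <= rnorm x.
Proof. by rewrite -ler0c -rnormE normr_ge0. Qed.

Lemma rnormD x y : rnorm (x + y) <= rnorm x + rnorm y.
Proof. rewrite -lecR rmorphD /=  -!rnormE. exact: ler_normD. Qed.

Lemma rnormN x : rnorm (- x) = rnorm x.
Proof. by rewrite /rnorm normrN. Qed.

Lemma rnormB x y : rnorm (x - y) = rnorm (y - x).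
Proof. by rewrite -rnormN opprB. Qed.

Lemma rnorm0 : rnorm 0 = 0.
Proof. by rewrite /rnorm normr0. Qed.

Lemma rnorm_le0 x : rnorm x <= 0 -> x = 0.
Proof.
move=> h; apply/eqP; rewrite -normr_eq0 rnormE.
by rewrite (_ : rnorm x = 0) //; apply/eqP; rewrite eq_le h rnorm_ge0.
Qed.

Lemma rnormM x y : rnorm (x * y) <= rnorm x * rnorm y.
Proof. rewrite -lecR rmorphM /= -!rnormE; exact: cstar_normM. Qed.

Lemma rnorm_star_mul x : rnorm (star x * x) = rnorm x ^+ 2.
Proof.
by have := @cstar_norm R A x; rewrite !rnormE -rmorphXn => /complexI.
Qed.

Lemma rnormZ r x : rnorm (r *r x) = `|r| * rnorm x.
Proof.
have := normrZ (real_complex R r) x.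
rewrite normc_def /= expr0n addr0 sqrtr_sqr !rnormE -rmorphM.
by move=> /complexI.
Qed.

Lemma cscaleAl (k : R[i]) x y : k *: (x * y) = (k *: x) * y.
Proof. exact: cstar_scaleAl. Qed.
Lemma cscaleAr (k : R[i]) x y : k *: (x * y) = x * (k *: y).
Proof. exact: cstar_scaleAr. Qed.

Lemma rscaleAl r x y : r *r (x * y) = (r *r x) * y.
Proof. exact: cstar_scaleAl. Qed.
Lemma rscaleAr r x y : r *r (x * y) = x * (r *r y).
Proof. exact: cstar_scaleAr. Qed.
Lemma rscaleDr r x y : r *r (x + y) = r *r x + r *r y.
Proof. exact: scalerDr. Qed.
Lemma rscaleNr r x : r *r (- x) = - (r *r x).
Proof. exact: scalerN. Qed.
Lemma rscaleBr r x y : r *r (x - y) = r *r x - r *r y.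
Proof. exact: scalerBr. Qed.
Lemma rscaleDl r s x : (r + s) *r x = r *r x + s *r x.
Proof. by rewrite /rscale rmorphD scalerDl. Qed.
Lemma rscaleNl r x : (- r) *r x = - (r *r x).
Proof. by rewrite /rscale rmorphN scaleNr. Qed.
Lemma rscaleA r s x : r *r (s *r x) = (r * s) *r x.
Proof. by rewrite /rscale rmorphM scalerA. Qed.
Lemma rscale1 x : 1 *r x = x.
Proof. exact: scale1r. Qed.
Lemma rscale0 x : 0 *r x = 0.
Proof. exact: scale0r. Qed.
Lemma rscale2 x : 2 *r x = x + x.
Proof. by rewrite (_ : 2 = 1 + 1 :> R) // rscaleDl rscale1. Qed.
Lemma rscaleI r x y : r != 0 -> r *r x = r *r y -> x = y.
Proof.
by move=> r0 /(congr1 (rscale r^-1)); rewrite !rscaleA mulVf // !rscale1.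
Qed.

Lemma commZ r x y : GRing.comm x y -> GRing.comm x (r *r y).
Proof. by move=> h; rewrite /GRing.comm -rscaleAl -rscaleAr h. Qed.

Lemma starB x y : star (x - y) = star x - star y.
Proof.
by rewrite -scaleN1r starD starZ rmorphN rmorph1 scaleN1r.
Qed.

Lemma starN x : star (- x) = - star x.
Proof. by rewrite -scaleN1r starZ rmorphN rmorph1 scaleN1r. Qed.

Lemma starMr x y : star (x * y) = star y * star x.
Proof. exact: starM. Qed.

Lemma star1 : star (1 : A) = 1.
Proof. by rewrite -[LHS]mulr1 -{2}(starK 1) -starMr mulr1 starK. Qed.

Lemma star_rscale r x : star (r *r x) = r *r star x.
Proof.
by rewrite /rscale starZ conj_Creal //; apply/complex_realP; exists r.
Qed.

(** Cancel one factor ||y|| in ||y||^2 = ||star y y|| <= ||star y|| ||y||, then use this for both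
    [x] and [star x]. *)
Lemma rnorm_star x : rnorm (star x) = rnorm x.
Proof.
have le y : rnorm y <= rnorm (star y).
  have [->|] := eqVneq (rnorm y) 0; first exact: rnorm_ge0.
  move=> y0; have yp : 0 < rnorm y by rewrite lt_neqAle eq_sym y0 rnorm_ge0.
  by rewrite -(ler_pM2r yp) -expr2 -rnorm_star_mul rnormM.
by apply/eqP; rewrite eq_le le andbT -{2}(starK x) le.
Qed.

Lemma rnorm_sa x : selfadjoint x -> rnorm (x * x) = rnorm x ^+ 2.
Proof. by move=> h; rewrite -rnorm_star_mul h. Qed.

(** From ||1|| = ||1||^2; the zero algebra, where ||1|| = 0, rules out an equality. *)
Lemma rnorm1 : rnorm 1 <= 1.
Proof.
have h : rnorm 1 = rnorm 1 ^+ 2 by rewrite -rnorm_star_mul star1 mulr1.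
have := rnorm_ge0 1; nra.
Qed.

Lemma rnorm_rscale1 r : 0 <= r -> rnorm (r *r 1) <= r.
Proof. by move=> r0; rewrite rnormZ ger0_norm // ler_piMr // rnorm1. Qed.

(** * Limits with an explicit rate *)

Lemma rnorm_complete (u : nat -> A) (e : nat -> R) :
  (forall m n, rnorm (u (m + n)%N - u n) <= e n) ->
  (forall eps, 0 < eps -> exists n, e n < eps) ->
  exists l, forall n, rnorm (l - u n) <= e n.
Proof.
move=> ue e0.
have : cauchy (u @ \oo).
  apply: cauchy_exP => eps eps0.
  have re : eps = real_complex R (complex.Re eps) by rewrite RRe_real // gtr0_real.
  have [|N eN] := e0 (complex.Re eps); first by rewrite -ltcR -re.
  exists (u N); exists N => // i /= Ni.
  rewrite -ball_normE /= distrC rnormE re ltcR.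
  by rewrite -(subnK Ni); apply: le_lt_trans eN; exact: ue.
move/cauchy_cvgP => /cvg_ex[l ul]; exists l => n.
apply/ler_addgt0Pr => eps eps0.
have /cvgr_dist_lt := ul => /(_ (real_complex R eps)).
rewrite ltcR => /(_ eps0) [N _ HN].
have /= := HN (N + n)%N (leq_addr _ _).
rewrite rnormE ltcR => h.
rewrite (_ : l - u n = (u (N + n)%N - u n) + (l - u (N + n)%N)); last first.
  by rewrite [RHS]addrC addrA subrK.
by rewrite (le_trans (rnormD _ _)) // lerD // ltW.
Qed.

(** Equations satisfied by a limit are proved by applying this to their defect. *)
Lemma rnorm_small x (C : R) (e : nat -> R) : 0 <= C ->
  (forall eps, 0 < eps -> exists n, e n < eps) ->
  (forall n, rnorm x <= C * e n) -> x = 0.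
Proof.
move=> C0 e0 xe; apply: rnorm_le0; apply/ler_addgt0Pr => eps eps0.
rewrite add0r; have C1 : 0 < C + 1 by rewrite ltr_wpDl.
have [|n en] := e0 (eps / (C + 1)); first by rewrite divr_gt0.
apply: le_trans (xe n) _; apply: (@le_trans _ _ (C * (eps / (C + 1)))).
  by rewrite ler_wpM2l // ltW.
by rewrite mulrCA ger_pMr // ler_pdivrMr // mul1r lerDl.
Qed.

Lemma geometric_small r C : 0 <= r < 1 -> 0 < C ->
  forall eps, 0 < eps -> exists n, r ^+ n / C < eps.
Proof.
move=> /andP[r0 r1] C0 eps eps0.
have /cvg_expr/cvgr_dist_lt : `|r| < 1 by rewrite ger0_norm.
have e0 : 0 < eps * C by rewrite mulr_gt0.
move=> /(_ _ e0) [N _ /(_ N (leqnn _))] /=.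
rewrite sub0r normrN ger0_norm ?exprn_ge0 // => h.
by exists N; rewrite ltr_pdivrMr.
Qed.

(** * Invertible elements and the Neumann series *)

(** If [v] inverts x y, then [v] commutes with [y], so y v is a two-sided inverse of [x]. *)
Lemma invertibleM x y : GRing.comm x y -> invertible (x * y) -> invertible x.
Proof.
move=> xy [v [vl vr]]; exists (y * v).
have e : v * y = y * v.
  rewrite -[LHS]mulr1 -vl !mulrA -[v * y * x]mulrA -xy.
  by rewrite vr mul1r.
split; first by rewrite mulrA.
by rewrite -e -mulrA -xy.
Qed.

Lemma rnormX x n : rnorm (x ^+ n) <= rnorm x ^+ n.
Proof.
elim: n => [|n IH]; first exact: rnorm1.
by rewrite !exprS (le_trans (rnormM _ _)) // ler_wpM2l // rnorm_ge0.
Qed.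

Lemma rnorm_sum n (f : nat -> A) :
  rnorm (\sum_(i < n) f i) <= \sum_(i < n) rnorm (f i).
Proof.
elim: n => [|n IH]; first by rewrite !big_ord0 rnorm0.
by rewrite !big_ord_recr /= (le_trans (rnormD _ _)) // lerD2r.
Qed.

(** Neumann series: the partial sums [u n] invert 1 - z up to z^n, with tails at most r^n / (1 -
    r). *)
Lemma invertible_1B z : rnorm z < 1 -> invertible (1 - z).
Proof.
set r := rnorm z => r1; have r0 : 0 <= r by exact: rnorm_ge0.
have r1' : 0 < 1 - r by rewrite subr_gt0.
pose u n : A := \sum_(i < n) z ^+ i.
have zu n : (1 - z) * u n = 1 - z ^+ n.
  elim: n => [|n IH]; first by rewrite /u big_ord0 mulr0 subrr.
  rewrite /u big_ord_recr /= mulrDr -/(u n) IH mulrBl mul1r -exprS.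
  by rewrite addrA subrK.
have uz n : u n * (1 - z) = 1 - z ^+ n.
  elim: n => [|n IH]; first by rewrite /u big_ord0 mul0r subrr.
  rewrite /u big_ord_recr /= mulrDl -/(u n) IH mulrBr mulr1 -exprSr.
  by rewrite addrA subrK.
have u_le m : rnorm (u m) <= (1 - r)^-1.
  apply: le_trans (rnorm_sum _ _) _.
  apply: (@le_trans _ _ (\sum_(i < m) r ^+ i)).
    by apply: ler_sum => i _; exact: rnormX.
  rewrite -[leRHS]mul1r ler_pdivlMr // mulrC -opprB mulNr -subrX1 opprB.
  by rewrite gerBl exprn_ge0.
pose e n := r ^+ n / (1 - r).
have e0 : forall eps, 0 < eps -> exists n, e n < eps.
  by apply: geometric_small => //; rewrite r0.
have [|l ul] := @rnorm_complete u e _ e0.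
  move=> m n; rewrite (_ : _ - _ = z ^+ n * u m); last first.
    elim: m => [|m IH]; first by rewrite add0n subrr /u big_ord0 mulr0.
    rewrite addSn /u !big_ord_recr /= mulrDr -/(u m) -IH.
    by rewrite [(m + n)%N]addnC exprD [(n + m)%N]addnC addrAC.
  apply: le_trans (rnormM _ _) _; apply: ler_pM; rewrite ?rnorm_ge0 //.
  exact: rnormX.
have n1z : rnorm (1 - z) <= 2.
  by rewrite (le_trans (rnormD _ _)) // rnormN lerD ?rnorm1 // ltW.
have zn n : rnorm (z ^+ n) <= e n.
  apply: le_trans (rnormX _ _) _; rewrite ler_peMr ?exprn_ge0 //.
  by rewrite invf_ge1 // gerBl.
(* The constant 3 is 2 for the product of 1 - z with l - u n, as ||1 - z|| <= 2, plus 1 for the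
   remainder z^n. *)
exists l; split; apply/subr0_eq; apply: (@rnorm_small _ 3 e) => // n.
- rewrite (_ : _ - 1 = (1 - z) * (l - u n) - z ^+ n); last first.
    by rewrite mulrBr zu opprB -!addrA [z ^+ n + _]addrC subrK.
  rewrite (le_trans (rnormD _ _)) // rnormN.
  have -> : 3 * e n = 2 * e n + e n by ring.
  rewrite lerD // (le_trans (rnormM _ _)) // ler_pM ?rnorm_ge0 //.
- rewrite (_ : _ - 1 = (l - u n) * (1 - z) - z ^+ n); last first.
    by rewrite mulrBl uz opprB -!addrA [z ^+ n + _]addrC subrK.
  rewrite (le_trans (rnormD _ _)) // rnormN.
  have -> : 3 * e n = 2 * e n + e n by ring.
  rewrite lerD // (le_trans (rnormM _ _)) // mulrC.
  by rewrite ler_pM ?rnorm_ge0.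
Qed.

(** * Square roots of 1 - z by iteration *)

(** The iteration for the scalar z = 1: it bounds the norms of the iterates, and its gap to 1 is the
    rate of convergence. *)
Fixpoint sqrt_bound n : R :=
  if n is m.+1 then (1 + sqrt_bound m ^+ 2) / 2 else 0.

Lemma sqrt_bound_itv n : 0 <= sqrt_bound n <= 1.
Proof. by elim: n => /= [|n IH]; [rewrite lexx ler01|nra]. Qed.

(** The induction closes because 1 + (N / (N + 2))^2 exceeds 2 (N + 1) / (N + 3) by 4 / ((N + 2)^2
    (N + 3)). *)
Lemma sqrt_bound_ge n : n%:R / (n%:R + 2) <= sqrt_bound n.
Proof.
elim: n => [|n IH] /=; first by rewrite mul0r.
have n0 : 0 <= n%:R :> R by exact: ler0n.
have /andP[s0 _] := sqrt_bound_itv n.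
set N : R := n%:R in IH n0 *; rewrite -[n.+1%:R]natr1 -/N.
have N2 : 0 < N + 2 by lra.
have N3 : 0 < N + 1 + 2 by lra.
have : (N / (N + 2)) ^+ 2 <= sqrt_bound n ^+ 2.
  by rewrite ler_pXn2r // nnegrE divr_ge0 // ltW.
set s := sqrt_bound n ^+ 2 => h.
rewrite ler_pdivlMr // -subr_ge0.
apply: (@le_trans _ _ (1 + (N / (N + 2)) ^+ 2 - (N + 1) / (N + 1 + 2) * 2)).
  rewrite (_ : _ - _ = 4 / ((N + 2) ^+ 2 * (N + 1 + 2))); last first.
    by field; rewrite !gt_eqF.
  by rewrite divr_ge0 // ltW // mulr_gt0 // exprn_gt0.
by rewrite lerD2r lerD2l.
Qed.

Lemma sqrt_bound_small eps : 0 < eps -> exists n, 1 - sqrt_bound n < eps.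
Proof.
(* The index is doubled because 2n / (2n + 2) = 1 - 1 / (n + 1). *)
move=> /ltr_add_invr[n]; rewrite add0r => h; exists n.*2.
apply: le_lt_trans h; rewrite lerBlDr -lerBlDl.
apply: le_trans (sqrt_bound_ge _); rewrite -[n.+1%:R]natr1 -muln2 natrM.
have n0 : 0 <= n%:R :> R by exact: ler0n.
rewrite (_ : _ / _ = 1 - (n%:R + 1)^-1) //.
by field; rewrite !gt_eqF //; lra.
Qed.

Fixpoint sqrt_iter z n : A :=
  if n is m.+1 then 2^-1 *r (z + sqrt_iter z m * sqrt_iter z m) else 0.

Lemma comm_sqrt_iter c z n : GRing.comm c z -> GRing.comm c (sqrt_iter z n).
Proof.
move=> cz; elim: n => [|n IH] /=; first exact: commr0.
by apply: commZ; apply: commrD => //; exact: commrM.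
Qed.

Lemma rnorm_half x : rnorm (2^-1 *r x) = rnorm x / 2.
Proof. by rewrite rnormZ ger0_norm ?invr_ge0 // mulrC. Qed.

Lemma rnorm_sqrt_iter z n :
  rnorm z <= 1 -> rnorm (sqrt_iter z n) <= sqrt_bound n.
Proof.
move=> z1; elim: n => [|n IH] /=; first by rewrite rnorm0.
rewrite rnorm_half ler_wpM2r ?invr_ge0 // (le_trans (rnormD _ _)) // lerD //.
by rewrite (le_trans (rnormM _ _)) // expr2 ler_pM ?rnorm_ge0.
Qed.

(* The factor (x + y) / 2 turns the gap [1 - s] into [(1 - s ^+ 2) / 2]. *)
Lemma rnorm_sqrt_step z x y s : GRing.comm x y -> rnorm x <= 1 ->
  rnorm y <= s -> rnorm (x - y) <= 1 - s ->
  rnorm (2^-1 *r (z + x * x) - 2^-1 *r (z + y * y)) <= 1 - (1 + s ^+ 2) / 2.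
Proof.
move=> xy x1 ys xys; rewrite -rscaleBr rnorm_half.
rewrite opprD addrACA subrr add0r.
rewrite (_ : x * x - y * y = (x - y) * (x + y)); last first.
  by rewrite mulrBl !mulrDr xy opprD addrA addrK.
have : rnorm ((x - y) * (x + y)) <= (1 - s) * (1 + s).
  rewrite (le_trans (rnormM _ _)) // ler_pM ?rnorm_ge0 //.
  by rewrite (le_trans (rnormD _ _)) // lerD.
lra.
Qed.

(** The equation is (1 - k)^2 = 1 - z expanded. Induction with [rnorm_sqrt_step] compares [u n] with
    later iterates, which gives the limit, and with any solution k', a fixed point of the iteration,
    which gives uniqueness. *)
Lemma sqrt_exists z : rnorm z <= 1 -> exists k, [/\ rnorm k <= 1,
  k + k = z + k * k, forall c, GRing.comm c z -> GRing.comm c k &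
  forall k', rnorm k' <= 1 -> k' + k' = z + k' * k' -> k' = k].
Proof.
move=> z1; pose u := sqrt_iter z; pose e n := 1 - sqrt_bound n.
have u1 n : rnorm (u n) <= 1.
  by rewrite (le_trans (rnorm_sqrt_iter _ z1)) //; have /andP[] := sqrt_bound_itv n.
have [|l ul] := @rnorm_complete u e _ sqrt_bound_small.
  move=> m n; elim: n => [|n IH].
    by rewrite addn0 subr0 /e subr0 u1.
  rewrite addnS /e /=; apply: rnorm_sqrt_step => //.
    by apply: comm_sqrt_iter; apply/commr_sym/comm_sqrt_iter.
  exact: rnorm_sqrt_iter.
have l1 : rnorm l <= 1.
  apply/ler_addgt0Pr => eps eps0; have [n en] := sqrt_bound_small eps0.
  rewrite -(subrK (u n) l) addrC (le_trans (rnormD _ _)) // lerD //.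
  by rewrite (le_trans (ul n)) // ltW.
have lc c : GRing.comm c z -> GRing.comm c l.
  move=> cz; apply/subr0_eq.
  apply: (@rnorm_small _ (2 * rnorm c) e) => [||n].
  - by rewrite mulr_ge0 // rnorm_ge0.
  - exact: sqrt_bound_small.
  rewrite (_ : _ - _ = c * (l - u n) - (l - u n) * c); last first.
    by rewrite mulrBl mulrBr (comm_sqrt_iter n cz) opprB addrA subrK.
  rewrite (le_trans (rnormD _ _)) // rnormN.
  have := rnormM c (l - u n); have := rnormM (l - u n) c.
  have := ul n; have := rnorm_ge0 c; nra.
exists l; split=> //.
(* The defect is 2 (l - f), where [f] is one iteration step from [l]. Both [l] and [f] lie within e
   (n + 1) <= e n of [u n.+1], hence the constant 4. *)
- apply/subr0_eq; apply: (@rnorm_small _ 4 e) => // [|n].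
    exact: sqrt_bound_small.
  have ll : GRing.comm l (u n) by apply: comm_sqrt_iter; apply/commr_sym/lc.
  pose f := 2^-1 *r (z + l * l).
  have fu : rnorm (f - u n.+1) <= e n.+1.
    exact: rnorm_sqrt_step ll l1 (rnorm_sqrt_iter n z1) (ul n).
  have := ul n.+1; move: fu; rewrite /e /=.
  rewrite (_ : l + l - _ = 2 *r ((l - u n.+1) - (f - u n.+1))); last first.
    rewrite opprB addrA subrK rscaleBr rscaleA divff // rscale1 rscale2.
    by rewrite opprD addrA.
  rewrite rnormZ ger0_norm //; set v := u n.+1.
  have := rnormD (l - v) (- (f - v)); rewrite rnormN.
  by have := sqrt_bound_itv n; set s := sqrt_bound n; nra.
- move=> k' k'1 ek'; apply/subr0_eq.
  apply: (@rnorm_small _ 2 e) => // [|n]; first exact: sqrt_bound_small.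
  (* Commuting with z makes k' commute with every iterate, as [rnorm_sqrt_step] requires. *)
  have ck' : GRing.comm k' z.
    rewrite (_ : z = k' + k' - k' * k'); last by rewrite ek' addrK.
    by apply: commrB; [apply: commrD|apply: commrM].
  suff h : rnorm (k' - u n) <= e n.
    by have := rnormB k' l; have := rnormD (k' - u n) (- (l - u n));
      rewrite rnormN opprB addrA subrK; have := ul n; lra.
  elim: n => [|n IH]; first by rewrite subr0 /e subr0.
  rewrite (_ : k' = 2^-1 *r (z + k' * k')); last first.
    by rewrite -ek' -rscale2 rscaleA mulVf // rscale1.
  apply: rnorm_sqrt_step => //; last exact: rnorm_sqrt_iter.
  exact: comm_sqrt_iter.
Qed.

(** * Norm estimates for self-adjoint elements *)

Lemma selfadjointD x y : selfadjoint x -> selfadjoint y -> selfadjoint (x + y).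
Proof. by rewrite /selfadjoint starD => -> ->. Qed.

Lemma selfadjointB x y : selfadjoint x -> selfadjoint y -> selfadjoint (x - y).
Proof. by rewrite /selfadjoint starB => -> ->. Qed.

Lemma selfadjointZ r x : selfadjoint x -> selfadjoint (r *r x).
Proof. by rewrite /selfadjoint star_rscale => ->. Qed.

Lemma selfadjointM x y : GRing.comm x y ->
  selfadjoint x -> selfadjoint y -> selfadjoint (x * y).
Proof. by rewrite /selfadjoint starMr => xy -> ->. Qed.

(** For u = x + i g, commutation gives star u u = x^2 + g^2, while 2 x = u + star u gives ||x|| <=
    ||u||. *)
Lemma rnorm_sum_sqr x g : selfadjoint x -> selfadjoint g -> GRing.comm x g ->
  rnorm x ^+ 2 <= rnorm (x * x + g * g).
Proof.
move=> sx sg xg; pose j : A := 'i *: g; pose u := x + j.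
have su : star u = x - j by rewrite starD starZ conjCi sx sg scaleNr.
have uu : star u * u = x * x + g * g.
  have xj : x * j = j * x.
    by rewrite -cscaleAr -cscaleAl xg.
  rewrite su mulrBl !mulrDr xj opprD addrA addrK; congr (_ + _).
  rewrite (_ : j * j = - (g * g)) ?opprK //.
  by rewrite -cscaleAl -cscaleAr scalerA -expr2 sqrCi scaleN1r.
have ux : rnorm (2 *r x) <= rnorm u + rnorm (star u).
  by rewrite (_ : 2 *r x = u + star u) ?rnormD // su /u rscale2 addrACA subrr addr0.
rewrite -uu rnorm_star_mul ler_pXn2r // ?nnegrE ?rnorm_ge0 //.
by move: ux; rewrite rnormZ ger0_norm // rnorm_star; lra.
Qed.

Lemma selfadjoint1 : selfadjoint (1 : A).
Proof. exact: star1. Qed.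

(** Take h = 1 - k; [k] is self-adjoint by uniqueness, since [star k] solves the same equation. *)
Lemma sqrt_1B_exists z : selfadjoint z -> rnorm z <= 1 -> exists h,
  [/\ selfadjoint h, rnorm (1 - h) <= 1, h * h = 1 - z &
  forall c, GRing.comm c z -> GRing.comm c h].
Proof.
move=> sz /sqrt_exists[k [k1 kz kc kU]]; exists (1 - k).
have sk : selfadjoint k.
  apply: kU; first by rewrite rnorm_star.
  by rewrite -starD kz starD starMr sz.
split.
- exact: selfadjointB selfadjoint1 sk.
- by rewrite opprB addrC subrK.
- rewrite mulrBl mul1r mulrBr mulr1 -addrA -opprD; congr (_ - _).
  by rewrite addrA kz addrK.
- by move=> c cz; apply: commrB; [exact: commr1|exact: kc].
Qed.

(** With w^2 = 1 - x^2, [rnorm_sum_sqr] bounds ||w||^2 by ||w^2 + x^2|| = ||1||. *)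
Lemma rnorm_1B_sqr x : selfadjoint x -> rnorm x <= 1 -> rnorm (1 - x * x) <= 1.
Proof.
move=> sx x1.
have xx1 : rnorm (x * x) <= 1 by rewrite rnorm_sa // expr_le1 // rnorm_ge0.
have sxx : selfadjoint (x * x) by exact: selfadjointM.
have [w [sw _ ww wc]] := sqrt_1B_exists sxx xx1.
rewrite -ww rnorm_sa //; have wx : GRing.comm w x.
  by apply/commr_sym/wc/commrM.
apply: le_trans (rnorm_sum_sqr sw sx wx) _.
by rewrite ww subrK rnorm1.
Qed.

Lemma invertible_inv_comm x y c : x * y = 1 -> y * x = 1 ->
  GRing.comm c x -> GRing.comm c y.
Proof.
move=> xy yx cx; rewrite /GRing.comm -[LHS]mul1r -{1}yx -mulrA (mulrA x).
by rewrite -cx -!mulrA xy mulr1.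
Qed.

(* If [v] inverts [w = (1 - x ^+ 2)^(1/2)] and [v] is scaled to norm at most 1,
   then [1 - v ^+ 2 = w3 ^+ 2] and [x ^+ 2 + (w * w3) ^+ 2] is a scalar below 1. *)
Lemma rnorm_lt1 x : selfadjoint x -> rnorm x <= 1 ->
  invertible (1 - x * x) -> rnorm x < 1.
Proof.
move=> sx x1.
have xx1 : rnorm (x * x) <= 1 by rewrite rnorm_sa // expr_le1 // rnorm_ge0.
have sxx : selfadjoint (x * x) by exact: selfadjointM.
have [w [sw _ ww wc]] := sqrt_1B_exists sxx xx1.
rewrite -ww => /invertibleM-/(_ erefl)[v [wv vw]].
have wx : GRing.comm w x by apply/commr_sym/wc/commrM.
have xv : GRing.comm x v.
  by apply: invertible_inv_comm wv vw _; exact: commr_sym.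
have wv' : GRing.comm w v by rewrite /GRing.comm wv vw.
have sv : selfadjoint v.
  rewrite /selfadjoint -[LHS]mulr1 -wv mulrA -{1}sw -starMr wv.
  by rewrite star1 mul1r.
(* Adding 1 makes m >= 1, so that the scalar 1 - m^-2 lies in [0, 1). *)
pose m := rnorm v + 1; have m1 : 1 <= m by rewrite lerDr rnorm_ge0.
have m0 : 0 < m by lra.
pose v' := m^-1 *r v.
have sv' : selfadjoint v' by exact: selfadjointZ.
have v'1 : rnorm v' <= 1.
  by rewrite rnormZ gtr0_norm ?invr_gt0 // mulrC ler_pdivrMr // mul1r lerDl.
have [|| w3 [sw3 _ w33 w3c]] := @sqrt_1B_exists (v' * v').
- exact: selfadjointM.
- by rewrite rnorm_sa // expr_le1 // rnorm_ge0.
have cv c : GRing.comm c v -> GRing.comm c w3.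
  by move=> cv; apply: w3c; apply: commrM; apply: commZ.
have ww3 := cv w wv'; have xw3 := cv x xv.
have : x * x + (w * w3) * (w * w3) = (1 - m^-1 ^+ 2) *r 1.
  rewrite -mulrA (mulrA w3) -ww3 !mulrA -mulrA w33 mulrBr mulr1.
  rewrite addrA {1}ww (addrC (x * x)) subrK rscaleDl rscale1 rscaleNl.
  congr (_ - _).
  rewrite -rscaleAl -!rscaleAr rscaleA -expr2; congr (_ *r _).
  by rewrite -mulrA (mulrA w v) wv mul1r wv.
have sww3 : selfadjoint (w * w3) by exact: selfadjointM.
have xww3 : GRing.comm x (w * w3) by apply: commrM => //; exact: commr_sym.
have := rnorm_sum_sqr sx sww3 xww3 => /[swap] -> h.
have mi : 0 < m^-1 ^+ 2 by rewrite exprn_gt0 // invr_gt0.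
have mi1 : m^-1 ^+ 2 <= 1 by rewrite expr_le1 ?invr_ge0 ?invf_le1 // ltW.
have : rnorm x ^+ 2 < 1.
  by apply: le_lt_trans h _; apply: le_lt_trans (rnorm_rscale1 _) _; lra.
by rewrite expr_lt1 // rnorm_ge0.
Qed.

(** * Positivity as a norm condition *)

(* Spectrum-free form of [positive]: see [npos_positive] and [positive_npos]. *)
Definition npos a := selfadjoint a /\ exists t, rnorm (t *r 1 - a) <= t.

Lemma npos_ge a t t' :
  rnorm (t *r 1 - a) <= t -> t <= t' -> rnorm (t' *r 1 - a) <= t'.
Proof.
move=> ta tt'; rewrite -[in t' *r 1](subrK t t') rscaleDl -addrA.
rewrite (le_trans (rnormD _ _)) // -[leRHS](subrK t t') lerD //.
by rewrite rnorm_rscale1 // subr_ge0.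
Qed.

Lemma npos_large a s : npos a -> exists2 t, s <= t & rnorm (t *r 1 - a) <= t.
Proof.
move=> [_ [t ta]]; exists (Num.max s t); first by rewrite le_max lexx.
by apply: npos_ge ta _; rewrite le_max lexx orbT.
Qed.

Lemma nposD a b : npos a -> npos b -> npos (a + b).
Proof.
move=> [sa [t ta]] [sb [s sb']]; split; first exact: selfadjointD.
exists (t + s); rewrite rscaleDl opprD addrACA.
by rewrite (le_trans (rnormD _ _)) // lerD.
Qed.

Lemma nposZ r a : 0 <= r -> npos a -> npos (r *r a).
Proof.
move=> r0 [sa [t ta]]; split; first exact: selfadjointZ.
by exists (r * t); rewrite -rscaleA -rscaleBr rnormZ ger0_norm // ler_wpM2l.
Qed.

(** Dividing [x] by m > ||x|| reduces this to [rnorm_1B_sqr], with t = m^2. *)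
Lemma npos_sqr x : selfadjoint x -> npos (x * x).
Proof.
move=> sx; split; first exact: selfadjointM.
pose m := rnorm x + 1; have m0 : 0 < m by rewrite ltr_wpDl // rnorm_ge0.
exists (m * m).
rewrite (_ : _ - _ = (m * m) *r (1 - (m^-1 *r x) * (m^-1 *r x))); last first.
  rewrite rscaleBr -rscaleAl -rscaleAr !rscaleA; congr (_ - _).
  by rewrite (_ : _ * _ * _ = 1) ?rscale1 //; field; rewrite gt_eqF.
rewrite rnormZ ger0_norm ?mulr_ge0 ?(ltW m0) // ler_piMr ?mulr_ge0 ?(ltW m0) //.
apply: rnorm_1B_sqr; first exact: selfadjointZ.
by rewrite rnormZ gtr0_norm ?invr_gt0 // mulrC ler_pdivrMr // mul1r lerDl.
Qed.

Lemma invertibleZ r x : r != 0 -> invertible x -> invertible (r *r x).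
Proof.
move=> r0 [y [xy yx]]; exists (r^-1 *r y).
by split; rewrite -rscaleAl -rscaleAr rscaleA ?divff ?mulVf // ?xy ?yx rscale1.
Qed.

Lemma invertibleN x : invertible x -> invertible (- x).
Proof. by move=> [y [xy yx]]; exists (- y); rewrite !mulrNN. Qed.

Lemma invertible_mul x y : invertible x -> invertible y -> invertible (x * y).
Proof.
move=> [u [xu ux]] [v [yv vy]]; exists (v * u); split.
  by rewrite mulrA -(mulrA x) yv mulr1.
by rewrite mulrA -(mulrA v) ux mulr1.
Qed.

(** Up to the factor t + s, this is 1 minus (t - a) / (t + s), whose norm is at most t / (t + s) <
    1. *)
Lemma npos_shift_invertible a s : npos a -> 0 < s -> invertible (a + s *r 1).
Proof.
move=> /(@npos_large a 0)[t t0 ta] s0.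
have ts : 0 < t + s by exact: ltr_wpDl.
rewrite (_ : a + _ = (t + s) *r (1 - (t + s)^-1 *r (t *r 1 - a))); last first.
  rewrite (rscaleBr (t + s)) rscaleA mulfV ?gt_eqF // rscale1 rscaleDl opprB.
  by rewrite [RHS]addrC addrA subrK.
apply: invertibleZ; first by rewrite gt_eqF.
apply: invertible_1B; rewrite rnormZ gtr0_norm ?invr_gt0 // mulrC.
by rewrite ltr_pdivrMr // mul1r (le_lt_trans ta) // ltrDl.
Qed.

Lemma scale_complexE (z : R[i]) x :
  z *: x = complex.Re z *r x + complex.Im z *r ('i *: x).
Proof. by rewrite /rscale scalerA -scalerDl -complexiE mulrC -complexE. Qed.

(* For [z = r + s i] with [s != 0], [(y + s i) (y - s i) = y ^+ 2 + s ^+ 2] is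
   invertible, where [y = r - a]. *)
Lemma positive_of_shift a : selfadjoint a ->
  (forall s, 0 < s -> invertible (a + s *r 1)) -> positive a.
Proof.
move=> sa ha; split=> // z za.
have [z_im|z_im] := eqVneq (complex.Im z) 0.
  rewrite lecE z_im eqxx /= leNgt; apply/negP => z_re; apply: za.
  rewrite scale_complexE z_im rscale0 addr0 -opprB; apply: invertibleN.
  by rewrite -rscaleNl; apply: ha; rewrite oppr_gt0.
exfalso; apply: za; rewrite scale_complexE; set r := complex.Re z.
set s := complex.Im z in z_im *; pose y := r *r 1 - a; pose j : A := 'i *: (1 : A).
have jx x : GRing.comm x j.
  by rewrite /GRing.comm -cscaleAl -cscaleAr mulr1 mul1r.
have jj : j * j = -1.
  by rewrite -cscaleAl -cscaleAr scalerA -expr2 sqrCi scaleN1r mulr1.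
have sy : selfadjoint y.
  by apply: selfadjointB => //; exact/selfadjointZ/selfadjoint1.
rewrite addrAC -/y; have yj : GRing.comm y (s *r j) by exact: commZ.
apply: (@invertibleM _ (y - s *r j)).
  by apply: commrB; apply: commr_sym; apply: commrD => //; exact: commr_sym.
rewrite mulrDl (mulrBr y) (mulrBr (s *r j)) -yj addrA subrK.
rewrite -rscaleAl -rscaleAr jj rscaleA rscaleNr opprK.
apply: npos_shift_invertible; first exact: npos_sqr.
by rewrite -expr2 exprn_even_gt0.
Qed.

Lemma npos_positive a : npos a -> positive a.
Proof.
move=> na; apply: positive_of_shift => [|s]; first by case: na.
exact: npos_shift_invertible.
Qed.

Lemma positive_shift a s : positive a -> 0 < s -> invertible (a + s *r 1).
Proof.
move=> [_ pa] s0; rewrite -(opprK (a + _)) opprD -rscaleNl addrC.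
apply: invertibleN; apply: contrapT => /pa.
by rewrite ler0c oppr_ge0 leNgt s0.
Qed.

(** If p = ||x|| > 1, the hypotheses at s = p - 1 make both factors of 1 - y^2 = (1 - y) (1 + y)
    invertible for y = x / p, against [rnorm_lt1]. *)
Lemma rnorm_le1 x : selfadjoint x ->
  (forall s, 0 < s -> invertible (1 - x + s *r 1)) ->
  (forall s, 0 < s -> invertible (1 + x + s *r 1)) -> rnorm x <= 1.
Proof.
move=> sx hB hD; rewrite leNgt; apply/negP; set p := rnorm x => p1.
have p0 : 0 < p by lra.
pose y := p^-1 *r x.
have y1 : rnorm y = 1 by rewrite rnormZ gtr0_norm ?invr_gt0 // mulVf // gt_eqF.
suff : rnorm y < 1 by rewrite y1 ltxx.
apply: rnorm_lt1; [exact: selfadjointZ|by rewrite y1|].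
rewrite (_ : 1 - y * y = (1 - y) * (1 + y)); last first.
  by rewrite mulrBl mul1r mulrDr mulr1 opprD addrA addrK.
have p1' : 0 < p - 1 by rewrite subr_gt0.
have one : p^-1 *r (1 + (p - 1) *r 1) = 1 :> A.
  rewrite -[X in X + _]rscale1 -rscaleDl rscaleA addrC subrK mulVf ?gt_eqF //.
  exact: rscale1.
apply: invertible_mul.
- rewrite (_ : 1 - y = p^-1 *r (1 - x + (p - 1) *r 1)).
    by apply: invertibleZ; [rewrite invr_eq0 gt_eqF|exact: hB].
  by rewrite addrAC rscaleBr one.
- rewrite (_ : 1 + y = p^-1 *r (1 + x + (p - 1) *r 1)).
    by apply: invertibleZ; [rewrite invr_eq0 gt_eqF|exact: hD].
  by rewrite addrAC rscaleDr one.
Qed.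

(** Apply [rnorm_le1] to x = 1 - a / t with t > ||a||: the shifts of 1 - x = a / t are invertible by
    positivity, those of 1 + x = 2 - a / t by the Neumann series. *)
Lemma positive_npos a : positive a -> npos a.
Proof.
move=> pa; have [sa _] := pa; split => //.
pose t := rnorm a + 1; have t0 : 0 < t by rewrite ltr_wpDl // rnorm_ge0.
have at1 : rnorm (t^-1 *r a) < 1.
  by rewrite rnormZ gtr0_norm ?invr_gt0 // mulrC ltr_pdivrMr // mul1r ltrDl.
exists t; set x := 1 - t^-1 *r a; suff x1 : rnorm x <= 1.
  rewrite (_ : _ - a = t *r x); last first.
    by rewrite rscaleBr rscaleA mulfV ?rscale1 ?gt_eqF.
  by rewrite rnormZ gtr0_norm // ler_piMr // ltW.
apply: rnorm_le1 => [|s s0|s s0].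
- by apply: selfadjointB; [exact: selfadjoint1|exact: selfadjointZ].
- rewrite /x opprB addrCA subrr addr0.
  rewrite (_ : _ + _ = t^-1 *r (a + (t * s) *r 1)).
    apply: invertibleZ; first by rewrite invr_eq0 gt_eqF.
    by apply: positive_shift => //; rewrite mulr_gt0.
  by rewrite rscaleDr rscaleA mulKf // gt_eqF.
- have s2 : 0 < 2 + s by lra.
  rewrite (_ : _ + _ = (2 + s) *r (1 - (2 + s)^-1 *r (t^-1 *r a))).
    apply: invertibleZ; first by rewrite gt_eqF.
    apply: invertible_1B; rewrite rnormZ gtr0_norm ?invr_gt0 //.
    by rewrite mulrC ltr_pdivrMr // mul1r; lra.
  rewrite (rscaleBr (2 + s)) [X in _ - X]rscaleA mulfV ?gt_eqF // rscale1.
  by rewrite rscaleDl rscale2 /x [RHS]addrAC addrA.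
Qed.

(** * Positive square roots and the absolute value *)

(** For y = x / m of norm at most 1, y^2 = 1 - z with z = 1 - y^2 in the unit ball; its root is
    scaled back by [m]. *)
Lemma sqrt_sqr_exists x : selfadjoint x -> exists h,
  [/\ npos h, h * h = x * x & forall c, GRing.comm c (x * x) -> GRing.comm c h].
Proof.
move=> sx; pose m := rnorm x + 1.
have m0 : 0 < m by rewrite ltr_wpDl // rnorm_ge0.
pose y := m^-1 *r x; have sy : selfadjoint y by exact: selfadjointZ.
have y1 : rnorm y <= 1.
  by rewrite rnormZ gtr0_norm ?invr_gt0 // mulrC ler_pdivrMr // mul1r lerDl.
have syy : selfadjoint (1 - y * y).
  by apply: selfadjointB; [exact: selfadjoint1|exact: selfadjointM].
have [h [sh h1 hh hc]] := sqrt_1B_exists syy (rnorm_1B_sqr sy y1).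
exists (m *r h); split.
- apply: nposZ; first exact: ltW.
  by split=> //; exists 1; rewrite rscale1.
- rewrite -rscaleAl -rscaleAr hh opprB addrC subrK.
  rewrite -rscaleAl -rscaleAr !rscaleA.
  by rewrite (_ : _ * _ = 1) ?rscale1 //; field; rewrite gt_eqF.
- move=> c cx; apply: commZ; apply: hc; apply: commrB; first exact: commr1.
  by rewrite -rscaleAl -rscaleAr; do 2!apply: commZ.
Qed.

(** For a common large t, 1 - y / t and 1 - y' / t solve the same equation in the unit ball, where
    [sqrt_exists] gives uniqueness. *)
Lemma npos_sqrt_unique y y' : npos y -> npos y' -> y * y = y' * y' -> y = y'.
Proof.
move=> ny ny' yy.
have [t1 yt1 ht1] := @npos_large y (rnorm y) ny.
have [t2 _ ht2] := @npos_large y' 0 ny'.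
pose t := Num.max t1 t2 + 1.
have t1t : t1 <= t by rewrite /t ler_wpDr // le_max lexx.
have t2t : t2 <= t by rewrite /t ler_wpDr // le_max lexx orbT.
have t0 : 0 < t by rewrite ltr_wpDl // le_max (le_trans (rnorm_ge0 y) yt1).
pose k (w : A) : A := 1 - t^-1 *r w.
have k1 w : rnorm (t *r 1 - w) <= t -> rnorm (k w) <= 1.
  move=> h; rewrite (_ : k w = t^-1 *r (t *r 1 - w)).
    by rewrite rnormZ gtr0_norm ?invr_gt0 // mulrC ler_pdivrMr // mul1r.
  by rewrite rscaleBr rscaleA mulVf ?rscale1 // gt_eqF.
pose z := 1 - (t^-1 *r y) * (t^-1 *r y).
have kz w : w * w = y * y -> k w + k w = z + k w * k w.
  move=> wy; rewrite /z -rscaleAl -rscaleAr -wy rscaleAr rscaleAl /k.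
  set v := t^-1 *r w; rewrite mulrBl mul1r mulrBr mulr1.
  by rewrite opprB [RHS]addrCA; congr (_ + _); rewrite addrA subrK.
have z1 : rnorm z <= 1.
  apply: rnorm_1B_sqr; first by apply: selfadjointZ; case: ny.
  by rewrite rnormZ gtr0_norm ?invr_gt0 // mulrC ler_pdivrMr // mul1r (le_trans yt1).
have [l [_ _ _ lU]] := sqrt_exists z1.
have : k y = k y'.
  have ky : k y = l by apply: lU; [exact/k1/(npos_ge ht1)|exact: kz].
  have ky' : k y' = l by apply: lU; [exact/k1/(npos_ge ht2)|exact: kz].
  by rewrite ky ky'.
move=> /addrI/oppr_inj; apply: rscaleI.
by rewrite invr_eq0 gt_eqF.
Qed.

(** Since h^2 = x^2, (h - x + s) (h + x + s) = 2 s (h + s / 2), which is invertible for s > 0. *)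
Lemma npos_sqrt_sub x h : selfadjoint x -> npos h -> h * h = x * x ->
  GRing.comm h x -> npos (h - x).
Proof.
move=> sx nh hh hx; apply/positive_npos/positive_of_shift => [|s s0].
  by apply: selfadjointB => //; case: nh.
apply: (@invertibleM _ (h + x + s *r 1)).
  have c1 w : GRing.comm w (s *r 1) by apply: commZ; exact: commr1.
  have ch : GRing.comm (h - x + s *r 1) h.
    apply: commr_sym; apply: commrD => //; exact: commrB.
  have cx : GRing.comm (h - x + s *r 1) x.
    apply: commr_sym; apply: commrD => //; apply: commrB => //; exact: commr_sym.
  by apply: commrD => //; exact: commrD.
rewrite (_ : _ * _ = (s + s) *r (h + (s / 2) *r 1)).
  apply: invertibleZ; first by rewrite gt_eqF // addr_gt0.
  by apply: npos_shift_invertible => //; rewrite divr_gt0.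
rewrite mulrDl !mulrDr !mulrBl hh hx [_ - _ + (_ - _)]addrA subrK subrr add0r.
rewrite -mulrBl -!rscaleAr mulr1 -!rscaleAl !mul1r -!rscaleDr.
rewrite (_ : s + s = s * 2); last by rewrite mulr2n mulrDr mulr1.
rewrite -(rscaleA s 2) (rscaleDr 2) (rscaleA 2) (mulrC 2) divfK // rscale2;
  congr (_ *r _).
by rewrite addrA [h + x]addrC addrA subrK.
Qed.

Lemma cabs_npos x : selfadjoint x -> npos (cabs x) /\ cabs x * cabs x = x * x.
Proof.
move=> sx; have [h [nh hh _]] := sqrt_sqr_exists sx.
(* A positive root exists, so [xget] does not fall back on its default 0. *)
have [|pc cc] := @xgetPex A 0 [set y | positive y /\ y ^+ 2 = star x * x].
  by exists h; split; [exact: npos_positive|rewrite sx].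
by split; [exact: positive_npos|rewrite -expr2 cc sx].
Qed.

Lemma cabs_eq x y : selfadjoint x -> npos y -> y * y = x * x -> cabs x = y.
Proof.
move=> sx ny yx; have [nc cc] := cabs_npos sx.
by apply: npos_sqrt_unique => //; rewrite cc.
Qed.

Lemma cabs_sub x : selfadjoint x -> npos (cabs x - x).
Proof.
move=> sx; have [h [nh hh hc]] := sqrt_sqr_exists sx.
rewrite (cabs_eq sx nh hh); apply: npos_sqrt_sub => //.
by apply/commr_sym/hc/commrM.
Qed.

Lemma cabsN x : cabs (- x) = cabs x.
Proof. by rewrite /cabs starN mulrNN. Qed.

Lemma cabs_add x : selfadjoint x -> npos (cabs x + x).
Proof.
move=> sx; rewrite -cabsN -{2}(opprK x); apply: cabs_sub.
by rewrite /selfadjoint starN sx.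
Qed.

(** * The unit interval *)

(** For x = 2 a - 1, 1 - x = 2 (1 - a) and 1 + x = 2 a are positive, so [rnorm_le1] applies. *)
Lemma unit_interval_rnorm a : unit_interval A a -> rnorm (a + a - 1) <= 1.
Proof.
case=> sa; rewrite /cle subr0 => pa p1a.
have n2a : npos (2 *r a) by apply: nposZ => //; exact: positive_npos.
have n21a : npos (2 *r (1 - a)) by apply: nposZ => //; exact: positive_npos.
apply: rnorm_le1 => [|s s0|s s0].
- apply: selfadjointB; last exact: selfadjoint1; exact: selfadjointD.
- rewrite (_ : 1 - _ = 2 *r (1 - a)); first exact: npos_shift_invertible.
  by rewrite rscale2 opprB addrA addrACA opprD.
- by rewrite [1 + _]addrC subrK -rscale2; exact: npos_shift_invertible.
Qed.

Lemma unit_interval_of_cabs a b : selfadjoint a -> selfadjoint b ->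
  cabs (a - b) + cabs (a + b - 1) = 1 -> unit_interval A a.
Proof.
move=> sa sb pq1; have sd : selfadjoint (a - b) by exact: selfadjointB.
have ss : selfadjoint (a + b - 1).
  by apply: selfadjointB (selfadjointD _ _) selfadjoint1.
have half x : npos (2 *r x) -> positive x.
  move=> nx; rewrite -(rscale1 x) -(@mulVf _ (2 : R)) // -rscaleA.
  by apply/npos_positive/nposZ; rewrite ?invr_ge0.
have e : (a - b) + (a + b - 1) = a + a - 1.
  by rewrite addrA [_ - b + _]addrACA addNr addr0.
split=> //; apply: half.
- rewrite subr0 rscale2.
  have := nposD (cabs_add sd) (cabs_add ss).
  by rewrite addrACA pq1 e addrC subrK.
- have := nposD (cabs_sub sd) (cabs_sub ss).
  rewrite addrACA pq1 -opprD e.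
  by rewrite rscale2 opprB addrA addrACA opprD.
Qed.

(** * The identity linking the two absolute values, and the equivalence *)

Lemma sqr_1B x : (1 - x) * (1 - x) = 1 - (x + x) + x * x.
Proof. by rewrite mulrBl mul1r mulrBr mulr1 opprB opprD !addrA addrAC. Qed.

(** Expand both squares and use (a + b)^2 = (a - b)^2 + 2 (ab + ba). *)
Lemma sqr_1B_jordan a b p : p * p = (a - b) * (a - b) ->
  (a + b - 1) * (a + b - 1) =
  (1 - p) * (1 - p) + 2 *r (a * b + b * a - (a + b - p)).
Proof.
move=> pp; rewrite -mulrNN opprB !sqr_1B.
have -> : (a + b) * (a + b) = p * p + 2 *r (a * b + b * a).
  have sqrD x y : (x + y) * (x + y) = x * x + y * y + (x * y + y * x).
    by rewrite mulrDl !mulrDr [y * x + _]addrC addrACA.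
  by rewrite pp !sqrD mulrNN mulrN mulNr -opprD rscale2 [RHS]addrA subrK.
rewrite -!rscale2 2!rscaleBr opprB.
rewrite [in RHS](addrCA (2 *r (_ + _))) [1 - 2 *r p + _]addrAC.
by rewrite [RHS]addrA subrK [LHS]addrAC !addrA.
Qed.

End CStarOrder.

Theorem proposition4p7 (R : realType) (A : cstarAlgType R) (a b : A)
    (ha : selfadjoint a) (hb : selfadjoint b) :
  cabs (a - b) + cabs (a + b - 1) = 1 <->
  [/\ unit_interval A a, unit_interval A b & jordan a b = dotmeet a b].
Proof.
have sd : selfadjoint (a - b) by exact: selfadjointB.
have ss : selfadjoint (a + b - 1).
  by apply: selfadjointB (selfadjointD _ _) selfadjoint1.
have [np pp] := cabs_npos sd; have key := sqr_1B_jordan pp.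
split=> [pq|[ua ub ab]].
  split; first exact: unit_interval_of_cabs pq.
    by apply: (@unit_interval_of_cabs _ _ b a) => //; rewrite -cabsN opprB (addrC b).
  (* Squaring q = 1 - p and comparing with [key] cancels (1 - p)^2. *)
  have [_] := cabs_npos ss; have -> : cabs (a + b - 1) = 1 - cabs (a - b).
    by apply: (addrI (cabs (a - b))); rewrite pq addrC subrK.
  rewrite key => /eqP; rewrite eq_sym -subr_eq0 addrAC subrr add0r => /eqP h.
  have {}h : a * b + b * a - (a + b - cabs (a - b)) = 0.
    by apply: (@rscaleI R A 2) => //; rewrite h /rscale scaler0.
  by rewrite /jordan (subr0_eq h).
move: key; have -> : a * b + b * a = a + b - cabs (a - b).
  by apply: (@scalerI _ _ (2^-1 : R[i])) => //; rewrite invr_eq0 pnatr_eq0.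
rewrite subrr /rscale scaler0 addr0 => h.
(* [h] says that 1 - p is a square root of q^2, so only its positivity is missing for it to equal
   q. *)
suff n1p : npos (1 - cabs (a - b)).
  by rewrite (cabs_eq ss n1p (esym h)) [LHS]addrC subrK.
split; first by apply: selfadjointB; [exact: selfadjoint1|case: np].
(* With t = 1 the condition is ||p|| <= 1, and ||p|| = ||a - b|| because the squares agree. *)
exists 1; rewrite rscale1 opprB [X in rnorm X]addrC subrK.
suff d1 : rnorm (a - b) <= 1.
  by case: np => sp _; rewrite -(@expr_le1 _ 2) ?rnorm_ge0 // -rnorm_sa // pp
    rnorm_sa // expr_le1 ?rnorm_ge0.
(* 2 (a - b) is the difference of 2 a - 1 and 2 b - 1, both of norm at most 1. *)
have := rnormD (a + a - 1) (- (b + b - 1)); rewrite rnormN.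
have -> : a + a - 1 - (b + b - 1) = rscale 2 (a - b).
  by rewrite rscale2 opprB addrA subrK opprD addrACA.
have := unit_interval_rnorm ua; have := unit_interval_rnorm ub.
by rewrite rnormZ ger0_norm //; lra.
Qed.
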